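(* Let $\Gamma$ be a discrete subgroup of $(\mathbb{C}^2,+)$ of $\mathbb{Z}$-rank three. Then there exist non-isomorphic quotient elliptic curves of $T=\mathbb{C}^2/\Gamma$, i.e. there are $\gamma_1,\gamma_2\in\Gamma\setminus H$ such that the elliptic curves $E_{\gamma_1}$ and $E_{\gamma_2}$ are not isomorphic.
   Context: An elliptic curve means a one-dimensional compact complex torus. Let $\Gamma\subset\mathbb{C}^2$ be a discrete subgroup of $\mathbb{Z}$-rank three and $T=\mathbb{C}^2/\Gamma$. Let $\Gamma_{\mathbb{R}}$ denote the $\mathbb{R}$-span of $\Gamma$ in $\mathbb{C}^2$ and $H=\Gamma_{\mathbb{R}}\cap i\Gamma_{\mathbb{R}}$. For $\gamma\in\Gamma\setminus H$, the quotient $S_\gamma=\mathbb{C}\gamma/(\mathbb{C}\gamma\cap\Gamma)$ is a closed complex Lie subgroup of $T$ isomorphic to $\mathbb{C}^*$, and $E_\gamma=T/S_\gamma$ is an elliptic curve; these $E_\gamma$ are the quotient elliptic curves of $T$. Equivalently, $E_\gamma$ is the quotient of $\mathbb{C}^2/\mathbb{C}\gamma$ by the image of $\Gamma$. ''Isomorphic'' means isomorphic as complex Lie groups (equivalently, biholomorphic). *)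

(* Defs.v *)
From HB Require Import structures.
From mathcomp Require Import all_boot all_order all_algebra.
From mathcomp Require Import generic_quotient ring_quotient complex.
From mathcomp Require Import all_classical all_reals all_analysis.

Set Implicit Arguments.
Unset Strict Implicit.
Unset Printing Implicit Defensive.

Import Order.TTheory GRing.Theory Num.Theory.
Import numFieldNormedType.Exports.

Local Open Scope classical_set_scope.
Local Open Scope ring_scope.
Local Open Scope complex_scope.

(* [R[i]^o] rather than [R[i]]: the regular module carries the normed-space
   structure, so that [Cplane R] is a normed module over [R[i]] and
   [differentiable] on it means complex differentiable. *)
Notation Cline R := (R[i]^o) (only parsing).
Notation Cplane R := 'rV[R[i]^o]_2 (only parsing).

Section DiscreteSubgroups.
Variables (R : realType) (Gamma : zmodClosed (Cplane R)).

Definition discrete_subgroup : Prop :=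
  forall v, v \in Gamma -> isolated [set` Gamma] v.

Definition has_Zrank (r : nat) : Prop :=
  exists b : 'I_r -> Cplane R,
    (forall n : 'I_r -> int, \sum_i b i *~ n i = 0 -> forall i, n i = 0) /\
    (forall v, v \in Gamma <-> exists n : 'I_r -> int, v = \sum_i b i *~ n i).

Definition real_span : set (Cplane R) :=
  [set v | exists (m : nat) (r : 'I_m -> R) (g : 'I_m -> Cplane R),
     (forall j, g j \in Gamma) /\ v = \sum_j (r j)%:C *: g j].

Definition maxcomplex : set (Cplane R) :=
  real_span `&` [set 'i%C *: v | v in real_span].

End DiscreteSubgroups.

Section QuotientCurve.
Variables (R : realType) (Gamma : zmodClosed (Cplane R)) (gamma : Cplane R).

Local Notation quotient_group := (Quotient.quot Gamma).

Definition quotient_group_proj (v : Cplane R) : quotient_group :=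
  \pi_quotient_group%qT v.

(* S_gamma, realised as the image of the line C gamma in C^2 / Gamma *)
Definition line_subgroup : {pred quotient_group} :=
  [pred t | `[< exists c : R[i], t = quotient_group_proj (c *: gamma) >]].

Fact line_subgroup_zmod_closed : zmod_closed line_subgroup.
Proof.
have piB (u v : Cplane R) :
    quotient_group_proj (u - v) = quotient_group_proj u - quotient_group_proj v.
  by rewrite /quotient_group_proj pi_addr pi_oppr.
split=> [|s t].
  apply/asboolP; exists 0.
  by rewrite scale0r -[X in quotient_group_proj X](subrr 0) piB subrr.
move=> /asboolP[a ->] /asboolP[b ->].
by apply/asboolP; exists (a - b); rewrite scalerBl piB.
Qed.

HB.instance Definition _ :=
  GRing.isZmodClosed.Build quotient_group line_subgroup
    line_subgroup_zmod_closed.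

Definition quotient_curve : zmodType := Quotient.quot line_subgroup.

Definition quotient_curve_proj (v : Cplane R) : quotient_curve :=
  \pi_(Quotient.quot line_subgroup)%qT (quotient_group_proj v).

End QuotientCurve.

(* The complex structure of a quotient [p : C^2 -> X] of complex Lie groups,
   given by its sheaf of holomorphic functions: U is open in X iff p^-1(U) is
   open in C^2, and g is holomorphic on U iff g o p is holomorphic on p^-1(U).
   A map is holomorphic iff it is continuous and pulls local holomorphic
   functions back to local holomorphic functions. *)
Section QuotientComplexStructure.
Variable R : realType.

Definition open_in_quotient (X : Type) (p : Cplane R -> X) (U : set X) : Prop :=
  open (p @^-1` U).

Definition holomorphic_on (X : Type) (p : Cplane R -> X) (U : set X)
    (g : X -> Cline R) : Prop :=
  forall z : Cplane R, U (p z) -> differentiable (g \o p) z.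

Definition holomorphic_map (X Y : Type) (p : Cplane R -> X) (q : Cplane R -> Y)
    (f : X -> Y) : Prop :=
  forall U : set Y, open_in_quotient q U ->
    open_in_quotient p (f @^-1` U) /\
    (forall g : Y -> Cline R,
       holomorphic_on q U g -> holomorphic_on p (f @^-1` U) (g \o f)).

Definition isomorphic_Lie_groups (X Y : zmodType)
    (p : Cplane R -> X) (q : Cplane R -> Y) : Prop :=
  exists (f : {additive X -> Y}) (g : Y -> X),
    [/\ cancel f g, cancel g f, holomorphic_map p q f & holomorphic_map q p g].

End QuotientComplexStructure.

Definition isomorphic_curves (R : realType) (Gamma : zmodClosed (Cplane R))
    (gamma1 gamma2 : Cplane R) : Prop :=
  isomorphic_Lie_groups (@quotient_curve_proj R Gamma gamma1)
                        (@quotient_curve_proj R Gamma gamma2).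

(* Main.v *)
Require Import Defs.
From HB Require Import structures.
From mathcomp Require Import all_boot all_order all_algebra complex.
From mathcomp Require Import generic_quotient ring_quotient ring lra.
From mathcomp Require Import all_classical all_reals all_analysis.

Set Implicit Arguments.
Unset Strict Implicit.
Unset Printing Implicit Defensive.

Import Order.TTheory GRing.Theory Num.Theory.
Import numFieldNormedType.Exports.
Local Open Scope classical_set_scope.
Local Open Scope ring_scope.

(** For a basis [e0, e1, e2] of [Gamma], the complex area form [det2 e0] kills
    exactly the line [C e0].  Divided by [det2 e0 e1], it maps [Gamma] onto the
    lattice [Z + Z tau] with [tau = det2 e0 e2 / det2 e0 e1], so that
    [E_e0 = C / (Z + Z tau)].  Discreteness makes [e0, e1, e2] independent over
    the reals, and this allows a choice of the basis for which [tau] is not real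
    ([exists_period_basis]); such an [e0] lies outside [H]
    ([period_basis_notin_maxcomplex]).

    Replacing the basis by [(n e0 + e1, - e0, e2)] replaces [tau] by
    [n tau + s] with a constant [s]; hence the curve of [n e0 + e1] has a period
    ratio whose imaginary part is as large as desired when [n] grows.  On the
    other hand the imaginary part of [tau'] is bounded when [Z + Z tau'] is
    similar to the fixed lattice [Z + Z tau] ([lattice_similarity_bound]): if
    [Z + Z tau'] equals [a (Z + Z tau)], then [1/a] lies in [Z + Z tau], which
    bounds [|a|] and [|a tau|] from above, while all elements of [Z + Z tau']
    of norm below [|Im tau'|] are integers.  A large [|Im tau'|] would thus make
    both [a] and [a tau] integers, and [tau] rational.  So [e0] and [n e0 + e1]
    have non-isomorphic curves for [n] large.

    It remains to see that an isomorphism of curves yields a similarity of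
    lattices ([isomorphic_curves_similar]).  Near the origin, a holomorphic
    morphism composed with a chart of the target is a function [phi] on [C^2]
    that is differentiable at 0.  Since the morphism is additive, [m phi (v / m)]
    lies for every large [m] in the class, modulo the lattice, of the image of
    [v]; it tends to ['d phi 0 v], and lattices are closed, so the morphism is
    induced by the linear map ['d phi 0] ([holomorphic_morphism_lift]).  That map
    kills the line of the source, hence is a multiple of its period map. *)

Local Notation Im := complex.Im.
Local Notation Re := complex.Re.

(** * Lattices in the complex line *)

Section ComplexNumbers.
Variable R : realType.
Implicit Types x y z : R[i].
Local Open Scope complex_scope.

Lemma ImD x y : Im (x + y) = Im x + Im y.
Proof. by case: x y => [? ?] [? ?]. Qed.

Lemma Im_realM (r : R) z : Im (r%:C * z) = r * Im z.
Proof. by case: z => a b /=; rewrite mul0r addr0. Qed.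

Lemma intrC (n : int) : n%:~R = (n%:~R : R)%:C :> R[i].
Proof. by rewrite rmorph_int. Qed.

Lemma Im_int_comb (s t : int) z : Im (s%:~R + t%:~R * z) = t%:~R * Im z.
Proof. by rewrite ImD !intrC Im_realM add0r. Qed.

Lemma normc_ge_Im z : `|Im z|%:C <= `|z|.
Proof.
have := normc_ge_Re (z * 'i%C).
rewrite ReiNIm normrN normrM complexiE normCi mulr1; exact.
Qed.

Lemma norm_real_complex (r : R) : `|r%:C| = `|r|%:C.
Proof. by rewrite normc_def /= expr0n addr0 sqrtr_sqr. Qed.

Lemma ltc0_real z : 0 < z -> exists2 r : R, 0 < r & z = r%:C.
Proof.
rewrite ltcE /= => /andP[/eqP zi zr]; exists (Re z) => //.
by case: z zi {zr} => a b /= ->.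
Qed.

End ComplexNumbers.

Definition lattice (R : realType) (tau : R[i]) : set R[i] :=
  [set w | exists s t : int, w = s%:~R + t%:~R * tau].

Section Lattice.
Variables (R : realType) (tau : R[i]).
Local Open Scope complex_scope.

Lemma lattice0 : lattice tau 0.
Proof. by exists 0, 0; rewrite mul0r addr0. Qed.

Lemma lattice1 : lattice tau 1.
Proof. by exists 1, 0; rewrite mul0r addr0. Qed.

Lemma lattice_tau : lattice tau tau.
Proof. by exists 0, 1; rewrite mul1r add0r. Qed.

Lemma latticeB u v : lattice tau u -> lattice tau v -> lattice tau (u - v).
Proof.
move=> [s [t ->]] [s' [t' ->]]; exists (s - s'), (t - t').
by rewrite !rmorphB; ring.
Qed.

Lemma latticeN u : lattice tau u -> lattice tau (- u).
Proof. by rewrite -sub0r; apply: latticeB lattice0. Qed.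

Lemma latticeD u v : lattice tau u -> lattice tau v -> lattice tau (u + v).
Proof. by move=> hu /latticeN hv; rewrite -[v]opprK; exact: latticeB. Qed.

Hypothesis tau_nonreal : Im tau != 0.

(** An element [s + t tau] with [t != 0] has imaginary part at least [|Im tau|]
    in absolute value, and with [t = 0] it is an integer. *)
Lemma lattice_gap :
  exists2 c : R, 0 < c & forall w, lattice tau w -> w != 0 -> c%:C <= `|w|.
Proof.
exists (Num.min 1 `|Im tau|); first by rewrite lt_min ltr01 normr_gt0.
move=> _ [s [t ->]] w0; have [t0|t0] := eqVneq t 0.
  move: w0; rewrite t0 mul0r addr0 intr_eq0 => s0.
  rewrite intrC norm_real_complex lecR ge_min; apply/orP; left.
  by rewrite -intr_norm -[1]/(1%:~R) ler_int -gtz0_ge1 normr_gt0.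
apply: le_trans (normc_ge_Im _); rewrite lecR Im_int_comb ge_min normrM.
apply/orP; right; rewrite ler_peMl //.
by rewrite -intr_norm -[1]/(1%:~R) ler_int -gtz0_ge1 normr_gt0.
Qed.

(** Two lattice points closer than the gap coincide, so approximations of [a] by
    lattice points are eventually constant. *)
Lemma lattice_closed a :
  (forall e : R, 0 < e -> exists2 w, lattice tau w & `|a - w| < e%:C) ->
  lattice tau a.
Proof.
move=> approx; have [c c0 gap] := lattice_gap.
have c2 : 0 < c / 2 by rewrite divr_gt0.
have [w Lw aw] := approx _ c2.
have [->//|neq] := eqVneq a w.
have /ltc0_real[d d0 dE] : 0 < `|a - w| by rewrite normr_gt0 subr_eq0.
have [w' Lw' aw'] := approx (Num.min (c / 2) d) ltac:(by rewrite lt_min c2).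
have [ww'|ww'] := eqVneq w' w.
  by move: aw'; rewrite ww' dE ltcR lt_min ltxx andbF.
have := gap _ (latticeB Lw Lw'); rewrite subr_eq0 eq_sym => /(_ ww').
move=> /le_lt_trans far; suff /far : `|w - w'| < c%:C by rewrite ltxx.
have -> : w - w' = (a - w') - (a - w) by ring.
apply: le_lt_trans (ler_normB _ _) _.
have -> : c%:C = (c / 2)%:C + (c / 2)%:C by rewrite -rmorphD -splitr.
apply: ltrD aw; apply: lt_le_trans aw' _.
by rewrite lecR ge_min lexx.
Qed.

(** The hypotheses hold when [lattice tau'] equals [a * lattice tau].  The last
    one bounds [|a|] by the inverse of the gap of [lattice tau], uniformly in
    [tau']; once [|Im tau'|] exceeds the norms of [a] and [a * tau], both are
    integers and [tau] is rational. *)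
Lemma lattice_similarity_bound :
  exists M : R, forall tau' a, a != 0 ->
    lattice tau' a -> lattice tau' (a * tau) -> lattice tau a^-1 ->
    `|Im tau'| <= M.
Proof.
have [c c0 gap] := lattice_gap.
pose T : R := Re `|tau|.
have TE : `|tau| = T%:C by rewrite /T normc_def.
exists ((1 + T) / c) => tau' a a0 [s [t aE]] [s' [t' atauE]] ainv.
rewrite leNgt; apply/negP => big.
have T0 : 0 <= T by rewrite -ler0c -TE.
have ci0 : 0 <= c^-1 by rewrite invr_ge0 ltW.
have acM : `|a| <= (c^-1)%:C.
  have := gap _ ainv; rewrite invr_eq0 => /(_ a0).
  rewrite normfV => h; rewrite -[`|a|]invrK fmorphV lef_pV2 //.
    by rewrite posrE invr_gt0 normr_gt0.
  by rewrite posrE ltcR.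
(* a lattice point of norm below the imaginary part of tau' is an integer *)
have small (b : R[i]) (m n : int) : b = m%:~R + n%:~R * tau' ->
    `|b| <= ((1 + T) / c)%:C -> n = 0.
  move=> bE bM; apply/eqP; apply: contraTT bM => n0.
  apply/negP => /(le_trans (normc_ge_Im _)); rewrite lecR; apply/negP.
  rewrite -ltNge bE Im_int_comb normrM; apply: lt_le_trans big _.
  by rewrite ler_peMl // -intr_norm -[1]/(1%:~R) ler_int -gtz0_ge1 normr_gt0.
have t0 : t = 0.
  apply: small aE _; apply: le_trans acM _; rewrite lecR ler_peMl //.
  by rewrite lerDl.
have t'0 : t' = 0.
  apply: small atauE _; rewrite normrM TE.
  apply: le_trans (_ : (c^-1)%:C * T%:C <= _).
    by rewrite ler_wpM2r // ler0c.
  by rewrite -rmorphM lecR mulrC ler_wpM2r // lerDr.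
move: aE atauE; rewrite t0 t'0 !mul0r !addr0 => aE.
move: a0; rewrite aE !intrC => a0 /(congr1 (@complex.Im R)).
rewrite Im_realM /= => /eqP; rewrite mulf_eq0 (negPf tau_nonreal) orbF.
move/eqP => s0; by rewrite s0 eqxx in a0.
Qed.

Lemma lattice_proper : exists w, ~ lattice tau w.
Proof.
have [c c0 gap] := lattice_gap.
have c2 : 0 < c / 2 by rewrite divr_gt0.
exists (c / 2)%:C%C => /gap.
have -> : (c / 2)%:C%C != 0 :> R[i].
  by rewrite -(rmorph0 (real_complex R)) (inj_eq (@complexI R)) gt_eqF.
by rewrite norm_real_complex gtr0_norm // lecR => /(_ isT); lra.
Qed.

End Lattice.

(** * Real independence of a basis of a discrete subgroup *)

Section RealIndependence.
Variables (R : realType) (r : nat) (b : 'I_r -> Cplane R).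
Local Open Scope complex_scope.

(** Dirichlet's approximation argument: the integer parts of the multiples [m x]
    give combinations of the [b i] that differ from zero by a combination with
    coefficients in [0, 1[; two of these coefficient vectors fall in the same
    box of side [1 / N], and their difference is small.  The normalisation
    [x k = 1] makes the [k]-th integer part of [m x] equal to [m], so that the
    difference is not trivial. *)
Lemma small_integer_combination (x : 'I_r -> R) (k : 'I_r) (e : R) : 0 < e ->
  x k = 1 -> \sum_i (x i)%:C *: b i = 0 ->
  exists2 n : 'I_r -> int, n k != 0 & `|\sum_i b i *~ n i| < e%:C.
Proof.
move=> e0 xk rel.
pose frac (m : nat) i : R := m%:R * x i - (Num.floor (m%:R * x i))%:~R.
have frac_itv m i : 0 <= frac m i < 1.
  by rewrite subr_ge0 floor_le ltrBlDl -intrD1 lt_succ_floor.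
pose S : R := Re (\sum_i `|b i|).
have SE : \sum_i `|b i| = S%:C.
  rewrite /S; apply/esym/RRe_real/ger0_real; exact: sumr_ge0.
have S0 : 0 <= S by rewrite -ler0c -SE sumr_ge0.
pose N := (Num.truncn (S / e)).+1.
have NS : S < N%:R * e by rewrite -ltr_pdivrMr // truncnS_gt.
have box_lt m i : (Num.truncn (N%:R * frac m i) < N)%N.
  have /andP[f0 f1] := frac_itv m i.
  rewrite -(ltr_nat R); apply: le_lt_trans (_ : N%:R * frac m i < _).
    by rewrite truncn_le ?mulr_ge0.
  by rewrite gtr_pMr // ltr0n.
pose box (m : 'I_(N ^ r).+1) : {ffun 'I_r -> 'I_N} :=
  [ffun i => Ordinal (box_lt m i)].
have /injectivePn[m [m' mm' boxE]] : ~~ injectiveb box.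
  apply/negP => /injectiveP/leq_card.
  by rewrite card_ffun !card_ord ltnn.
pose fl (m : nat) i : int := Num.floor (m%:R * x i).
exists (fun i => fl m i - fl m' i).
  rewrite /fl xk !mulr1 !pmulrn !intrKfloor subr_eq0 eqz_nat.
  by apply: contra_neq mm' => /val_inj.
have close i : `|frac m i - frac m' i| < N%:R^-1.
  (* the multiples of both fractional parts by N share their integer part *)
  move/ffunP/(_ i): boxE; rewrite !ffunE => -[boxE].
  have N0 : 0 < N%:R :> R by rewrite ltr0n.
  have trunc_itv m0 :=
    truncn_itv (mulr_ge0 (ltW N0) (proj1 (andP (frac_itv m0 i)))).
  have := trunc_itv m; have := trunc_itv m'; rewrite boxE.
  have -> : frac m i - frac m' i =
      (N%:R * frac m i - N%:R * frac m' i) * N%:R^-1.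
    by rewrite -mulrBr mulrAC divff ?mul1r ?gt_eqF.
  rewrite normrM normfV (gtr0_norm N0) gtr_pMl ?invr_gt0 // -!natr1.
  move=> /andP[? ?] /andP[? ?].
  by rewrite ltr_norml; apply/andP; split; lra.
have -> : \sum_i b i *~ (fl m i - fl m' i) =
    \sum_i (frac m' i - frac m i)%:C *: b i.
  have comb m0 : \sum_i b i *~ fl m0 i = - \sum_i (frac m0 i)%:C *: b i.
    apply/eqP; rewrite -addr_eq0 -big_split /=; apply/eqP.
    rewrite -[RHS](_ : (m0%:R : R[i]) *: \sum_i (x i)%:C *: b i = 0);
      last by rewrite rel scaler0.
    rewrite scaler_sumr.
    apply: eq_bigr => i _; rewrite scalerA -scaler_int -scalerDl; congr (_ *: _).
    by rewrite /frac rmorphB /= rmorph_int rmorphM rmorph_nat /fl; ring.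
  under eq_bigr do rewrite mulrzBr.
  rewrite sumrB !comb opprK addrC -sumrB.
  by apply: eq_bigr => i _; rewrite -scalerBl [in RHS]rmorphB.
apply: le_lt_trans (ler_norm_sum _ _ _) _.
apply: le_lt_trans (_ : (S / N%:R)%:C < _); last first.
  by rewrite ltcR ltr_pdivrMr ?ltr0n // mulrC.
rewrite rmorphM /= -SE mulr_suml; apply: ler_sum => i _.
rewrite normrZ mulrC ler_wpM2l // norm_real_complex lecR distrC.
exact: ltW.
Qed.

Variable Gamma : zmodClosed (Cplane R).

(** A real relation, scaled to have a coefficient 1, would produce nonzero
    elements of [Gamma] arbitrarily close to 0. *)
Lemma discrete_basis_real_free (x : 'I_r -> R) :
  discrete_subgroup Gamma -> (forall i, b i \in Gamma) ->
  (forall n : 'I_r -> int, \sum_i b i *~ n i = 0 -> forall i, n i = 0) ->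
  \sum_i (x i)%:C *: b i = 0 -> forall i, x i = 0.
Proof.
move=> discr bG free rel k; apply: contrapT => /eqP xk0.
have [_ [V /nbhs_ballP[e /= e0 eV] VG]] := discr 0 (rpred0 _).
have [e' e'0 eE] := ltc0_real e0.
have [||n nk small] :=
    @small_integer_combination (fun i => x i / x k) k e' e'0.
- by rewrite divff.
- under eq_bigr do rewrite mulrC rmorphM -scalerA.
  by rewrite -scaler_sumr rel scaler0.
have /free/(_ k)/eqP : \sum_i b i *~ n i = 0; last exact/negP.
suff : [set (0 : Cplane R)] (\sum_i b i *~ n i) by [].
rewrite -VG; split; last by rewrite /= rpred_sum // => i _; rewrite rpredMz.
by apply: eV; rewrite -ball_normE /= sub0r normrN eE.
Qed.

End RealIndependence.

(** * Bases with a non-real period ratio *)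

(** The area form of the complex plane; for [u != 0], [det2 u] is a linear form with
    kernel the line spanned by [u]. *)
Definition det2 (R : realType) (u v : Cplane R) : R[i] :=
  u 0 0 * v 0 1 - u 0 1 * v 0 0.

Definition generated_by (R : realType) (Gamma : zmodClosed (Cplane R))
    (e0 e1 e2 : Cplane R) : Prop :=
  forall v, v \in Gamma <->
    exists a b c : int, v = e0 *~ a + e1 *~ b + e2 *~ c.

Definition period_ratio (R : realType) (e0 e1 e2 : Cplane R) : R[i] :=
  det2 e0 e2 / det2 e0 e1.

(** The basis exhibits the curve of [e0] as the quotient of the complex line by
    the lattice of [period_ratio e0 e1 e2]. *)
Definition period_basis (R : realType) (Gamma : zmodClosed (Cplane R))
    (e0 e1 e2 : Cplane R) : Prop :=
  [/\ generated_by Gamma e0 e1 e2, det2 e0 e1 != 0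
    & complex.Im (period_ratio e0 e1 e2) != 0].

Lemma ord2P (j : 'I_2) : j = 0 \/ j = 1.
Proof. by case: j => [[|[|]]] // ?; [left|right]; apply/val_inj. Qed.

Section Det2.
Variable R : realType.
Implicit Types u v w : Cplane R.

Lemma det2vv u : det2 u u = 0.
Proof. by rewrite /det2; ring. Qed.

Lemma det2C u v : det2 u v = - det2 v u.
Proof. by rewrite /det2; ring. Qed.

Lemma det2_is_linear u : linear (det2 u : Cplane R -> R[i]^o).
Proof. by move=> a v w; rewrite /det2 !mxE /= /GRing.scale /=; ring. Qed.

HB.instance Definition _ u := GRing.isLinear.Build R[i] (Cplane R) R[i]^o _
  (det2 u : Cplane R -> R[i]^o) (det2_is_linear u).

Lemma det2Zl a u v : det2 (a *: u) v = a * det2 u v.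
Proof. by rewrite /det2 !mxE; ring. Qed.

Lemma det2Dl u v w : det2 (u + v) w = det2 u w + det2 v w.
Proof. by rewrite /det2 !mxE; ring. Qed.

Lemma det2Zr a u v : det2 u (a *: v) = a * det2 u v.
Proof. by rewrite linearZ. Qed.

Lemma det2Dr u v w : det2 u (v + w) = det2 u v + det2 u w.
Proof. by rewrite linearD. Qed.

Lemma det2Mz u v (n : int) : det2 u (v *~ n) = n%:~R * det2 u v.
Proof. by rewrite raddfMz mulrzl. Qed.

Lemma det2_eq0 u v : u != 0 -> det2 u v = 0 -> exists c, v = c *: u.
Proof.
move=> u0 uv.
have [j uj] : exists j, u 0 j != 0.
  apply: contrapT => /forallNP h; case/eqP: u0; apply/rowP => j.
  by rewrite mxE; apply/eqP; apply: contrapT => /negP; exact: h.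
exists (v 0 j / u 0 j); apply/rowP => k; rewrite mxE.
apply: (mulfI uj); rewrite [RHS]mulrA mulrCA divff // mulr1.
have {}uv : u 0 0 * v 0 1 = u 0 1 * v 0 0.
  by apply/eqP; rewrite -subr_eq0 -/(det2 u v) uv.
have [->|->] : j = 0 \/ j = 1 by exact: ord2P.
  have [->|->] : k = 0 \/ k = 1 by exact: ord2P.
    by rewrite mulrC.
  by rewrite uv mulrC.
have [->|->] : k = 0 \/ k = 1 by exact: ord2P.
  by rewrite -uv mulrC.
by rewrite mulrC.
Qed.

End Det2.

Section PeriodBasis.
Variables (R : realType) (Gamma : zmodClosed (Cplane R)).
Implicit Types e b : Cplane R.
Local Open Scope complex_scope.

Lemma generated_by_swap01 e0 e1 e2 :
  generated_by Gamma e0 e1 e2 -> generated_by Gamma e1 e0 e2.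
Proof.
move=> gen v; rewrite gen; split=> -[a [b [c ->]]]; exists b, a, c;
  by rewrite [_ *~ b + _]addrC.
Qed.

Lemma generated_by_rotate e0 e1 e2 :
  generated_by Gamma e0 e1 e2 -> generated_by Gamma e2 e0 e1.
Proof.
move=> gen v; rewrite gen; split=> [[a [b [c ->]]]|[c [a [b ->]]]].
  by exists c, a, b; rewrite addrC addrA.
by exists a, b, c; rewrite -addrA addrC.
Qed.

Lemma generated_by_shear (n : int) e0 e1 e2 :
  generated_by Gamma e0 e1 e2 -> generated_by Gamma (e0 *~ n + e1) (- e0) e2.
Proof.
move=> gen v; rewrite gen; split=> -[a [b [c ->]]].
  exists b, (n * b - a), c; congr (_ + _).
  by rewrite mulrzDl -mulrzA mulNrz mulrzBr opprB [RHS]addrC addrA subrK.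
exists (n * a - b), a, c; congr (_ + _).
by rewrite mulrzDl -mulrzA mulNrz mulrzBr addrAC.
Qed.

(** The form is alternating, so shearing by [e0] leaves the area
    [det2 e0 e1] unchanged, while the area spanned with [e2] grows linearly. *)
Lemma period_ratio_shear (n : int) e0 e1 e2 : det2 e0 e1 != 0 ->
  det2 (e0 *~ n + e1) (- e0) = det2 e0 e1 /\
  period_ratio (e0 *~ n + e1) (- e0) e2 =
    n%:~R * period_ratio e0 e1 e2 + det2 e1 e2 / det2 e0 e1.
Proof.
move=> p0; have dE : det2 (e0 *~ n + e1) (- e0) = det2 e0 e1.
  by rewrite raddfN /= -scaler_int det2Dl det2Zl det2vv mulr0 add0r -det2C.
split=> //; rewrite /period_ratio dE -scaler_int det2Dl det2Zl.
by rewrite mulrDl mulrA.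
Qed.

(** If [b1 = c b0], then [c] is not real by independence; [b2] is not a multiple
    of [b0], since a complex line has real dimension two, and [c] is the period
    ratio of [(b2, b0, b1)].  Otherwise, a real period ratio [t] of
    [(b0, b1, b2)] means that [b2 - t b1] is a multiple [c b0]; again [c] is not
    real, and it is the period ratio of [(b1, b0, b2)]. *)
Lemma exists_period_basis b0 b1 b2 : generated_by Gamma b0 b1 b2 ->
  (forall x y z : R, x%:C *: b0 + y%:C *: b1 + z%:C *: b2 = 0 ->
     [/\ x = 0, y = 0 & z = 0]) ->
  exists e0 e1 e2, period_basis Gamma e0 e1 e2.
Proof.
move=> gen free.
have real_of (z : R[i]) : Im z = 0 -> z = (Re z)%:C by case: z => a b /= ->.
have b00 : b0 != 0.
  apply/eqP => b00; have [] := free 1 0 0; last by move=> /eqP; rewrite oner_eq0.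
  by rewrite b00 scaler0 !scale0r !addr0.
have [p0|p0] := eqVneq (det2 b0 b1) 0.
  have [c cE] := det2_eq0 b00 p0.
  have cI : Im c != 0.
    apply/eqP => /real_of cR; have [] := free (- Re c) 1 0.
      by rewrite scale0r addr0 scale1r cE {2}cR rmorphN scaleNr addNr.
    by move=> _ /eqP; rewrite oner_eq0.
  have q0 : det2 b0 b2 != 0.
    apply/eqP => /(det2_eq0 b00)[d dE].
    (* this real relation between 1, c and d holds for all complex c and d *)
    have [] := free (Im d * Re c - Im c * Re d) (- Im d) (Im c); last first.
      by move=> _ _ /eqP; apply/negP.
    rewrite cE dE !scalerA -!scalerDl; apply/eqP; rewrite scaler_eq0; apply/orP; left.
    case: (c) (d) => [c1 c2] [d1 d2] /=; rewrite eq_complex /=.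
    by apply/andP; split; apply/eqP; ring.
  exists b2, b0, b1; split; first exact: generated_by_rotate.
    by rewrite det2C oppr_eq0.
  have -> : period_ratio b2 b0 b1 = c; last by [].
  by rewrite /period_ratio cE linearZ /= mulfK // det2C oppr_eq0.
have [qR|qI] := eqVneq (Im (period_ratio b0 b1 b2)) 0; last first.
  by exists b0, b1, b2.
have /(det2_eq0 b00)[c cE] : det2 b0 (b2 - period_ratio b0 b1 b2 *: b1) = 0.
  by rewrite linearB linearZ /= /GRing.scale /= divfK // subrr.
have cI : Im c != 0.
  apply/eqP => /real_of cR.
  have [] := free (- Re c) (- Re (period_ratio b0 b1 b2)) 1.
    rewrite !rmorphN /= -cR -(real_of _ qR) !scaleNr -cE opprB scale1r.
    by rewrite addrAC subrK subrr.
  by move=> _ _ /eqP; rewrite oner_eq0.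
exists b1, b0, b2; split; first exact: generated_by_swap01.
  by rewrite det2C oppr_eq0.
have -> : period_ratio b1 b0 b2 = c; last by [].
rewrite /period_ratio -[b2](subrK (period_ratio b0 b1 b2 *: b1)) cE linearD !linearZ /=.
rewrite det2vv scaler0 addr0 /GRing.scale /= mulfK //.
by rewrite det2C oppr_eq0.
Qed.

End PeriodBasis.

(** * The quotient curve and its period map *)

Section QuotientCurve.
Variables (R : realType) (Gamma : zmodClosed (Cplane R)) (gamma : Cplane R).
Local Notation proj := (@quotient_curve_proj R Gamma gamma).
Implicit Types u v : Cplane R.

Lemma quotient_curve_projB u v : proj (u - v) = proj u - proj v.
Proof.
rewrite /quotient_curve_proj.
have -> : quotient_group_proj Gamma (u - v) =
    quotient_group_proj Gamma u - quotient_group_proj Gamma v.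
  by rewrite /quotient_group_proj pi_addr pi_oppr.
by rewrite pi_addr pi_oppr.
Qed.

Lemma quotient_curve_proj0 : proj 0 = 0.
Proof. by rewrite -[X in proj X](subrr 0) quotient_curve_projB subrr. Qed.

Lemma quotient_curve_projN u : proj (- u) = - proj u.
Proof. by rewrite -[- u]sub0r quotient_curve_projB quotient_curve_proj0 sub0r. Qed.

Lemma quotient_curve_projMn u n : proj (u *+ n) = proj u *+ n.
Proof.
elim: n => [|n IHn]; first by rewrite !mulr0n quotient_curve_proj0.
by rewrite !mulrSr -IHn -[proj u]opprK -quotient_curve_projN -quotient_curve_projB opprK.
Qed.

Lemma quotient_curve_proj_surj y : exists v, proj v = y.
Proof.
exists (repr (repr y)); rewrite /quotient_curve_proj /quotient_group_proj.
by rewrite !reprK.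
Qed.

Lemma quotient_curve_proj_eq0 v :
  proj v = 0 <-> exists (c : R[i]) g, g \in Gamma /\ v = c *: gamma + g.
Proof.
have group_projB u : quotient_group_proj Gamma u - quotient_group_proj Gamma 0 =
    quotient_group_proj Gamma u.
  by rewrite /quotient_group_proj -pi_oppr -pi_addr subr0.
rewrite -quotient_curve_proj0; split.
  move=> /eqquotP; rewrite Quotient.equivE group_projB.
  move=> /asboolP[c /eqquotP]; rewrite Quotient.equivE => vc.
  by exists c, (v - c *: gamma); rewrite subrKC.
move=> [c [g [gG ->]]]; apply/eqquotP; rewrite Quotient.equivE group_projB.
apply/asboolP; exists c; apply/eqquotP; rewrite Quotient.equivE.
by rewrite addrC addrA addNr add0r.
Qed.

End QuotientCurve.

(** [l] presents the curve of [gamma] as the quotient of the complex line by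
    [lattice tau]. *)
Definition period_map (R : realType) (Gamma : zmodClosed (Cplane R))
    (gamma : Cplane R) (l : {linear Cplane R -> R[i]^o}) (tau : R[i]) : Prop :=
  [/\ continuous l, forall v, l v = 0 <-> exists c : R[i], v = c *: gamma
    & forall w, lattice tau w <-> exists2 g, g \in Gamma & l g = w].

Lemma proj_eq0_lattice (R : realType) (Gamma : zmodClosed (Cplane R))
    (gamma : Cplane R) (l : {linear Cplane R -> R[i]^o}) (tau : R[i]) v :
  period_map Gamma gamma l tau ->
  quotient_curve_proj Gamma gamma v = 0 <-> lattice tau (l v).
Proof.
move=> [_ ker im]; rewrite quotient_curve_proj_eq0 im; split.
  move=> [c [g [gG ->]]]; exists g => //; rewrite linearD.
  by rewrite (proj2 (ker (c *: gamma))) ?add0r //; exists c.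
move=> [g gG lg]; have /ker[c vg] : l (v - g) = 0 by rewrite linearB /= lg subrr.
by exists c, g; split=> //; rewrite -vg subrK.
Qed.

Lemma coord_combination_continuous (K : numFieldType) (a b : K) :
  continuous (fun v : 'rV[K]_2 => a * v 0 1 - b * v 0 0).
Proof.
move=> v; have coord (c : K) i : c * x 0 i @[x --> v] --> c * v 0 i.
  exact: (@cvgMl_tmp K _ (nbhs v) _ _ c _ (@coord_continuous K 1 2 0 i v)).
exact: (@cvgB K K _ (nbhs v) _ _ _ _ _ (coord a 1) (coord b 0)).
Qed.

Section PeriodBasisCurve.
Variables (R : realType) (Gamma : zmodClosed (Cplane R)).
Variables e0 e1 e2 : Cplane R.
Hypothesis basis : period_basis Gamma e0 e1 e2.
Local Notation tau := (period_ratio e0 e1 e2).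
Local Notation l := (det2 ((det2 e0 e1)^-1 *: e0) : Cplane R -> R[i]^o).
Local Open Scope complex_scope.

Lemma period_map_basis : period_map Gamma e0 l tau.
Proof.
have [gen p0 _] := basis.
have lE v : l v = det2 e0 v / det2 e0 e1 by rewrite det2Zl mulrC.
split.
- exact: (@coord_combination_continuous R[i]).
- move=> v; rewrite -[X in X = 0]/(l v) lE; split=> [/eqP|[c ->]]; last first.
    by rewrite linearZ /= det2vv scaler0 mul0r.
  rewrite mulf_eq0 invr_eq0 (negPf p0) orbF => /eqP/det2_eq0; apply.
  by apply: contraNneq p0 => ->; rewrite -(scale0r 0) det2Zl mul0r.
have lcomb (a b c : int) : l (e0 *~ a + e1 *~ b + e2 *~ c) = b%:~R + c%:~R * tau.
  rewrite lE !det2Dr !det2Mz det2vv mulr0 add0r.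
  by rewrite mulrDl mulfK // mulrA.
move=> w; split=> [[b [c ->]]|[v /gen[a [b [c ->]]] <-]].
  exists (e0 *~ 0 + e1 *~ b + e2 *~ c); last exact: lcomb.
  by apply/gen; exists 0, b, c.
by exists b, c; exact: lcomb.
Qed.

Lemma real_span_generated v : real_span Gamma v ->
  exists x y z : R, v = x%:C *: e0 + y%:C *: e1 + z%:C *: e2.
Proof.
have [gen _ _] := basis; move=> [m [r [g [gG ->]]]].
apply: (big_ind (fun w => exists x y z : R,
  w = x%:C *: e0 + y%:C *: e1 + z%:C *: e2)).
- by exists 0, 0, 0; rewrite !scale0r !addr0.
- move=> _ _ [x [y [z ->]]] [x' [y' [z' ->]]]; exists (x + x'), (y + y'), (z + z').
  by rewrite !rmorphD !scalerDl /= addrACA; congr (_ + _); rewrite addrACA.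
move=> j _; have /gen[a [b [c ->]]] := gG j.
exists (r j * a%:~R), (r j * b%:~R), (r j * c%:~R).
by rewrite !rmorphM /= -!intrC -!scalerA !scaler_int !scalerDr.
Qed.

(** If [e0 = 'i v] with [v] in the real span, then [det2 e0] vanishes at [v].
    Since 1 and the period ratio are independent over the reals, [v] is a real
    multiple of [e0], which contradicts [e0 = 'i v]. *)
Lemma period_basis_notin_maxcomplex : ~ maxcomplex Gamma e0.
Proof.
have [_ p0 tauI] := basis; have [_ ker _] := period_map_basis.
have e00 : e0 != 0.
  by apply: contraNneq p0 => ->; rewrite -(scale0r 0) det2Zl mul0r.
move=> [_ [v /real_span_generated[x [y [z ->]]] ve0]].
have : det2 e0 ('i *: (x%:C *: e0 + y%:C *: e1 + z%:C *: e2)) = 0.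
  by rewrite ve0 det2vv.
rewrite det2Zr !det2Dr !det2Zr det2vv mulr0 add0r.
move/eqP; rewrite mulf_eq0 => /orP[/eqP[/eqP]|/eqP yz0]; first by rewrite oner_eq0.
have {}yz0 : y%:C + z%:C * tau = 0.
  by rewrite /period_ratio mulrA -[y%:C](mulfK p0) -mulrDl yz0 mul0r.
have z0 : z = 0.
  have /eqP := congr1 (@complex.Im R) yz0.
  by rewrite ImD Im_realM add0r mulf_eq0 (negPf tauI) orbF => /eqP.
move: yz0; rewrite z0 mul0r addr0 => y0.
move/eqP: ve0; rewrite z0 y0 !scale0r !addr0 scalerA -subr_eq0.
rewrite -[X in _ - X]scale1r -scalerBl scaler_eq0 (negPf e00) orbF.
by rewrite eq_complex /= => /andP[/eqP re0 _]; lra.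
Qed.

End PeriodBasisCurve.

(** * Differentiability *)

Lemma near_eq_differentiable (K : numFieldType) (V W : normedModType K)
    (f g : V -> W) (x : V) :
  (\forall z \near x, f z = g z) -> differentiable f x -> differentiable g x.
Proof.
move=> fg df; have fgx : f x = g x := nbhs_singleton fg.
have expansion : g \o shift x = cst (g x) + 'd f x +o_ 0 id.
  apply/eqaddoP => e e0.
  have /eqaddoP/(_ e e0) := diff_locally df.
  apply: filterS2; last by move: fg; rewrite (near_shift 0 x); exact.
  by move=> h; rewrite /= subr0 => fgh; rewrite !fctE /= fgx fgh.
apply/diff_locallyP; rewrite (diff_unique (diff_continuous df) expansion).
by split=> //; exact: diff_continuous.
Qed.

Lemma diff_quotient_near (K : numFieldType) (V W : normedModType K)
    (phi : V -> W) (N : set V) (v : V) (e : K) :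
  phi 0 = 0 -> differentiable phi 0 -> nbhs 0 N -> 0 < e ->
  exists2 r : K, 0 < r & forall h, h != 0 -> `|h| < r ->
    N (h *: v) /\ `|'d phi 0 v - h^-1 *: phi (h *: v)| < e.
Proof.
move=> phi0 dphi N0 e0.
have quot : (fun h : K => h^-1 *: phi (h *: v)) @ 0^' --> 'd phi 0 v.
  rewrite -deriveE //; have := diff_derivable (v := v) dphi.
  rewrite /derivable /derive /shift /=.
  by under eq_fun do rewrite addr0 phi0 subr0.
have scale0 : (fun h : K => h *: v) @ (0 : K) --> (0 : V).
  by rewrite -[X in _ --> X](scale0r v); exact: scalel_continuous.
have : \forall h \near (0 : K), h != 0 ->
    N (h *: v) /\ `|'d phi 0 v - h^-1 *: phi (h *: v)| < e.
  have /cvgrPdist_lt/(_ e e0) := quot; rewrite near_withinE /= => quot_e.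
  have NN : \forall h \near (0 : K), N (h *: v) by exact: scale0.
  by apply: filterS2 NN quot_e => h Nh qh h0; split => //; exact: qh.
move=> /nbhs_ballP[r /= r0 rB]; exists r => // h h0 hr.
by apply: rB => //; rewrite -ball_normE /= sub0r normrN.
Qed.

(** The step of the difference quotient is taken of the form [1 / m] because
    additivity of a morphism controls only the integer multiples. *)
Lemma diff_quotient_nat (R : realType) (V W : normedModType R[i]) (phi : V -> W)
    (N : set V) (v : V) (e : R) :
  phi 0 = 0 -> differentiable phi 0 -> nbhs 0 N -> 0 < e ->
  exists2 m : nat, (0 < m)%N &
    N ((m%:R : R[i])^-1 *: v) /\
    `|'d phi 0 v - phi ((m%:R : R[i])^-1 *: v) *+ m| < e%:C%C.
Proof.
move=> phi0 dphi N0 e0.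
have e0C : 0 < e%:C%C by rewrite ltcR.
have [r /ltc0_real[s s0 ->] small] := diff_quotient_near v phi0 dphi N0 e0C.
pose m := (Num.truncn s^-1).+1.
have m0 : 0 < m%:R :> R by rewrite ltr0n.
exists m => //; have [||] := small m%:R^-1.
- by rewrite invr_eq0 pnatr_eq0.
- rewrite -(rmorph_nat (real_complex R)) -fmorphV norm_real_complex ltcR.
  by rewrite gtr0_norm ?invr_gt0 // invf_plt ?posrE // truncnS_gt.
by rewrite invrK scaler_nat.
Qed.

(** * Charts of the quotient curve *)

Section LocalChart.
Variables (R : realType) (Gamma : zmodClosed (Cplane R)) (gamma : Cplane R).
Variables (l : {linear Cplane R -> R[i]^o}) (tau : R[i]) (r : R).
Local Notation proj := (@quotient_curve_proj R Gamma gamma).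
Local Open Scope complex_scope.

(** The image in the curve of the disc of radius [r]; the period map, restricted
    to this disc, has an inverse there as soon as [r] is at most half of the gap of the lattice. *)
Definition disc_image : set (quotient_curve Gamma gamma) :=
  [set y | exists2 z, proj z = y & `|l z| < r%:C].

Definition disc_chart (y : quotient_curve Gamma gamma) : R[i]^o :=
  xget 0 [set w | `|w| < r%:C /\ exists2 z, proj z = y & l z = w].

Hypothesis lP : period_map Gamma gamma l tau.
Hypothesis gap : forall w, lattice tau w -> w != 0 -> (r *+ 2)%:C <= `|w|.

(** Lattice points at distance less than [2 r] coincide, so [l z - d] is the
    only representative of the class of [z] in the disc. *)
Lemma disc_chartE z d : lattice tau d -> `|l z - d| < r%:C ->
  disc_chart (proj z) = l z - d.
Proof.
move=> Ld zd; have [_ _ /(_ d)[/(_ Ld)[g gG gd] _]] := lP.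
apply: xget_unique => [|w [wr [z' z'z lz']]].
  split=> //; exists (z - g); last by rewrite linearB /= gd.
  rewrite quotient_curve_projB [X in _ - X](proj2 (proj_eq0_lattice g lP)) ?subr0 //.
  by rewrite gd.
have Ldiff : lattice tau (w - (l z - d)).
  rewrite opprB addrCA addrC; apply: latticeD => //.
  rewrite -lz' -linearB; apply/(proj_eq0_lattice _ lP).
  by rewrite quotient_curve_projB z'z subrr.
apply/eqP; rewrite -subr_eq0; apply: contrapT => /negP neq.
have := gap Ldiff neq => /le_lt_trans far.
suff /far : `|w - (l z - d)| < (r *+ 2)%:C by rewrite ltxx.
apply: le_lt_trans (ler_normB _ _) _.
by rewrite mulr2n rmorphD /=; exact: ltrD.
Qed.

Lemma near_disc z d : `|l z - d| < r%:C ->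
  \forall z' \near z, `|l z' - d| < r%:C.
Proof.
move=> zd; have [lc _ _] := lP.
have dB : nbhs (l z) (ball (d : R[i]^o) r%:C).
  apply: open_nbhs_nbhs; split; last by rewrite -ball_normE /= distrC.
  by apply: ball_open; apply: le_lt_trans zd.
have := lc z _ dB; rewrite nbhs_simpl /=; apply: filterS => z' /=.
by rewrite -ball_normE /= distrC.
Qed.

Lemma disc_imageP z : disc_image (proj z) ->
  exists2 d, lattice tau d & `|l z - d| < r%:C.
Proof.
move=> [z' z'z lz']; exists (l z - l z'); last by rewrite opprB addrCA subrr addr0.
rewrite -linearB; apply/(proj_eq0_lattice _ lP).
by rewrite quotient_curve_projB z'z subrr.
Qed.

Lemma disc_image_open : open_in_quotient proj disc_image.
Proof.
rewrite /open_in_quotient openE => z /disc_imageP[d Ld /near_disc].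
apply: filterS => z' z'd; have [_ _ /(_ d)[/(_ Ld)[g gG gd] _]] := lP.
exists (z' - g); last by rewrite linearB /= gd.
rewrite quotient_curve_projB [X in _ - X](proj2 (proj_eq0_lattice g lP)) ?subr0 //.
by rewrite gd.
Qed.

(** On each sheet the chart is a translate of the period map. *)
Lemma disc_chart_holomorphic : holomorphic_on proj disc_image disc_chart.
Proof.
move=> z /disc_imageP[d Ld /near_disc zd]; have [lc _ _] := lP.
apply: (@near_eq_differentiable _ _ _ (fun z' => l z' - cst d z')).
  by apply: filterS zd => z' z'd; rewrite /= (disc_chartE Ld).
apply: differentiableB; first exact: linear_differentiable.
exact: differentiable_cst.
Qed.

End LocalChart.

(** * Isomorphic curves have similar lattices *)

Section Isomorphism.
Variables (R : realType) (Gamma : zmodClosed (Cplane R)).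
Variables (gamma1 gamma2 : Cplane R) (l1 l2 : {linear Cplane R -> R[i]^o}).
Variables (tau1 tau2 : R[i]).
Hypotheses (lP1 : period_map Gamma gamma1 l1 tau1)
           (lP2 : period_map Gamma gamma2 l2 tau2)
           (tau1_nonreal : Im tau1 != 0) (tau2_nonreal : Im tau2 != 0).
Local Notation p := (@quotient_curve_proj R Gamma gamma1).
Local Notation q := (@quotient_curve_proj R Gamma gamma2).
Local Open Scope complex_scope.

(** [A] is the differential at the origin of the morphism read in a chart [phi];
    for [m] large, [m phi (v / m)] is congruent to [l2 y] modulo the lattice, and these
    numbers approach [A v]. *)
Lemma holomorphic_morphism_lift
    (f : {additive quotient_curve Gamma gamma1 -> quotient_curve Gamma gamma2}) :
  holomorphic_map p q f ->
  exists A : {linear Cplane R -> R[i]^o},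
    forall v y, f (p v) = q y -> lattice tau2 (l2 y - A v).
Proof.
move=> fhol; have [c c0 gap] := lattice_gap tau2_nonreal.
pose r := c / 2; have r0 : 0 < r by rewrite divr_gt0.
have r2 : r *+ 2 = c by rewrite -mulr_natr divfK.
have {}gap w : lattice tau2 w -> w != 0 -> (r *+ 2)%:C <= `|w|.
  by rewrite r2; exact: gap.
pose U := disc_image (Gamma := Gamma) (gamma := gamma2) l2 r.
pose g := disc_chart (Gamma := Gamma) (gamma := gamma2) l2 r.
have [W_open hol] := fhol U (disc_image_open lP2).
have {hol} := hol g (disc_chart_holomorphic lP2 gap).
have fp0 : f (p 0) = q 0 by rewrite !quotient_curve_proj0 raddf0.
have U0 : U (q 0) by exists 0; rewrite // linear0 normr0 ltcR.
move=> /(_ 0); rewrite /= fp0 => /(_ U0) phi_diff.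
have W0 : nbhs (0 : Cplane R) (p @^-1` (f @^-1` U)).
  by apply: open_nbhs_nbhs; split; rewrite //= fp0.
have phi0 : ((g \o f) \o p) 0 = 0.
  rewrite /= fp0 /g (disc_chartE (d := 0) lP2 gap); last 2 first.
  - exact: lattice0.
  - by rewrite linear0 subr0 normr0 ltcR.
  by rewrite linear0 subr0.
exists ('d ((g \o f) \o p) (0 : Cplane R)) => v y fpv.
apply: lattice_closed => // e e0.
have [m m0 [[z qz lz] small]] := diff_quotient_nat v phi0 phi_diff W0 e0.
exists (l2 y - l2 z *+ m).
  rewrite -raddfMn -raddfB /=; apply/(proj_eq0_lattice _ lP2).
  rewrite quotient_curve_projB quotient_curve_projMn qz -raddfMn -quotient_curve_projMn.
  rewrite -scaler_nat scalerA divff ?pnatr_eq0 -?lt0n // scale1r.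
  by apply/eqP; rewrite subr_eq0 fpv.
have -> : l2 z = ((g \o f) \o p) ((m%:R : R[i])^-1 *: v).
  rewrite /= -qz /g (disc_chartE (d := 0) lP2 gap) ?subr0 //.
  exact: lattice0.
by rewrite opprB addrC addrA subrK distrC.
Qed.

(** For the lift [A] of the isomorphism, [A v] is in [lattice tau2] exactly when
    [p v = 0], by injectivity.  Therefore [A] vanishes on [gamma1], because a
    lattice contains no complex line, and factors as [a l1]; then [w] is in
    [lattice tau1] iff [a w] is in [lattice tau2].  The three memberships are
    the cases [w = 1], [w = tau1] and [w = 1 / a]. *)
Lemma isomorphic_curves_similar : isomorphic_curves Gamma gamma1 gamma2 ->
  exists a : R[i], [/\ a != 0, lattice tau2 a, lattice tau2 (a * tau1)
                     & lattice tau1 a^-1].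
Proof.
move=> [f [g [fK gK fhol _]]]; have [A AP] := holomorphic_morphism_lift fhol.
have [lc1 ker1 im1] := lP1; have [lc2 ker2 im2] := lP2.
have Alattice v : p v = 0 <-> lattice tau2 (A v).
  split=> [pv|Av].
    have := AP v 0; rewrite pv raddf0 quotient_curve_proj0 linear0 sub0r.
    by move=> /(_ erefl)/latticeN; rewrite opprK.
  have [y qy] := quotient_curve_proj_surj (f (p v)).
  apply: (can_inj fK); rewrite raddf0 -qy; apply/(proj_eq0_lattice _ lP2).
  by rewrite -[l2 y](subrK (A v)); apply: latticeD Av; exact: AP.
have Agamma : A gamma1 = 0.
  apply: contrapT => /eqP A0; have [w] := lattice_proper tau2_nonreal; apply.
  pose s := w / A gamma1.
  have /Alattice : p (s *: gamma1) = 0.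
    apply/(proj_eq0_lattice _ lP1); rewrite (proj2 (ker1 _)); first exact: lattice0.
    by exists s.
  by rewrite linearZ /= /GRing.scale /= divfK.
have [e1 e1G le1] := (proj1 (im1 1)) (lattice1 _).
have AE v : A v = A e1 * l1 v.
  have /ker1[s sE] : l1 (v - l1 v *: e1) = 0.
    by rewrite linearB linearZ /= le1 /GRing.scale /= mulr1 subrr.
  rewrite -{1}[v](subrK (l1 v *: e1)) sE linearD !linearZ /= Agamma scaler0 add0r.
  by rewrite /GRing.scale /= mulrC.
have similar v : lattice tau1 (l1 v) <-> lattice tau2 (A e1 * l1 v).
  by rewrite -AE -(proj_eq0_lattice _ lP1).
have l1_surj w : exists v, l1 v = w.
  by exists (w *: e1); rewrite linearZ /= le1 /GRing.scale /= mulr1.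
have {}similar w : lattice tau1 w <-> lattice tau2 (A e1 * w).
  by have [v <-] := l1_surj w.
have a0 : A e1 != 0.
  apply/eqP => a0; have [w] := lattice_proper tau1_nonreal; apply.
  by apply/similar; rewrite a0 mul0r; exact: lattice0.
exists (A e1); split => //.
- by rewrite -[A e1]mulr1; apply/similar; exact: lattice1.
- by apply/similar; exact: lattice_tau.
- by apply/similar; rewrite divff //; exact: lattice1.
Qed.
End Isomorphism.

(** * Two curves that are not isomorphic *)

Lemma exists_sheared_ratio (R : realType) (tau s : R[i]) (M : R) :
  Im tau != 0 -> exists n : nat, M < `|Im (n%:~R * tau + s)|.
Proof.
move=> tauI; have t0 : 0 < `|Im tau| by rewrite normr_gt0.
exists (Num.truncn ((M + `|Im s|) / `|Im tau|)).+1.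
set n := _.+1; rewrite ImD (intrC _ n) Im_realM.
have : M + `|Im s| < n%:R * `|Im tau|.
  by rewrite -ltr_pdivrMr // truncnS_gt.
rewrite -ltrBrDr => /lt_le_trans; apply.
have -> : n%:R * `|Im tau| = `|n%:R * Im tau| by rewrite normrM normr_nat.
exact: lerB_normD.
Qed.

Theorem proposition1 (R : realType) (Gamma : zmodClosed (Cplane R))
    (Gamma_discrete : discrete_subgroup Gamma)
    (Gamma_rank3 : has_Zrank Gamma 3) :
  exists gamma1 gamma2 : Cplane R,
    [/\ gamma1 \in Gamma /\ ~ maxcomplex Gamma gamma1,
        gamma2 \in Gamma /\ ~ maxcomplex Gamma gamma2
      & ~ isomorphic_curves Gamma gamma1 gamma2].
Proof.
have [b [free gen]] := Gamma_rank3.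
have sum3 (V : zmodType) (F : 'I_3 -> V) : \sum_i F i = F 0 + F 1 + F 2%:R.
  rewrite !big_ord_recl big_ord0 addr0 addrA.
  by congr (F _ + F _ + F _); exact: val_inj.
pose triple (T : Type) (x y z : T) (i : 'I_3) : T := nth x [:: x; y; z] i.
have bG i : b i \in Gamma.
  apply/gen; exists (fun j => (i == j)%:R); rewrite (bigD1 i) //= eqxx.
  by rewrite big1 ?addr0 // => j ji; rewrite eq_sym (negPf ji).
have gen3 : generated_by Gamma (b 0) (b 1) (b 2%:R).
  move=> v; rewrite gen; split=> [[n ->]|[x [y [z ->]]]].
    by exists (n 0), (n 1), (n 2%:R); rewrite sum3.
  by exists (triple _ x y z); rewrite sum3.
have free3 (x y z : R) : x%:C%C *: b 0 + y%:C%C *: b 1 + z%:C%C *: b 2%:R = 0 ->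
    [/\ x = 0, y = 0 & z = 0].
  move=> rel; have all0 : forall i, triple _ x y z i = 0.
    by apply: discrete_basis_real_free Gamma_discrete bG free _; rewrite sum3.
  by split; [exact: (all0 0)|exact: (all0 1)|exact: (all0 2%:R)].
have [e0 [e1 [e2 basis]]] := exists_period_basis gen3 free3.
have [gen_e p0 tauI] := basis.
have [M bound] := lattice_similarity_bound tauI.
have [n big] := exists_sheared_ratio (det2 e1 e2 / det2 e0 e1) `|M| tauI.
have [p'E tau'E] := period_ratio_shear n e2 p0.
have basis' : period_basis Gamma (e0 *~ n + e1) (- e0) e2.
  split; [exact: generated_by_shear|by rewrite p'E|].
  by rewrite tau'E -normr_gt0; apply: le_lt_trans big.
have mem_basis f0 f1 f2 : generated_by Gamma f0 f1 f2 -> f0 \in Gamma.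
  by move=> ->; exists 1, 0, 0; rewrite !mulr0z !addr0.
exists e0, (e0 *~ n + e1); split.
- by split; [exact: mem_basis gen_e|exact: period_basis_notin_maxcomplex basis].
- have [gen' _ _] := basis'.
  by split; [exact: mem_basis gen'|exact: period_basis_notin_maxcomplex basis'].
have [_ _ tau'I] := basis'.
move=> /(isomorphic_curves_similar (period_map_basis basis)
  (period_map_basis basis') tauI tau'I)[a [a0 La Latau Lainv]].
have := bound _ _ a0 La Latau Lainv; rewrite tau'E => /(lt_le_trans big).
by rewrite ltNge ler_norm.
Qed.
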